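(* If $s\in\mathbb{N}_0$, then the entire function $\eta_s(z)=\sum_{n\ge 0}\frac{n^s}{\Gamma(n+1)}\frac{z^n}{n!}$ belongs to the class $\mathcal{LP}^{+}$.
   Context: $\mathbb{N}_0=\{0,1,2,\dots\}$, and $0^0=1$ (so that $\eta_0(z)=\sum_{n\ge0}\frac{z^n}{(n!)^2}$). A real entire function $w$ is of type I in the Laguerre–Pólya class, written $w\in\mathcal{LP}I$, if $w(z)$ or $w(-z)$ can be represented as $c z^m e^{\sigma z}\prod_{k\ge 1}\left(1+\frac{z}{z_k}\right)$ with $c\in\mathbb{R}$, $\sigma\ge 0$, $m\in\mathbb{N}_0$, $z_k>0$, $\sum_{k\ge 1} z_k^{-1}<\infty$ (the product may be finite or empty). A function $\varphi(z)=\sum_{k\ge 0}\gamma_k\frac{z^k}{k!}\in\mathcal{LP}I$ is said to belong to $\mathcal{LP}^{+}$ if $\gamma_k\ge 0$ for all $k\in\mathbb{N}_0$. *)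

(* Defs.v *)
From HB Require Import structures.
From mathcomp Require Import all_boot all_order all_algebra.
From mathcomp Require Import all_classical all_reals all_analysis.
From mathcomp Require Import complex.

Set Implicit Arguments.
Unset Strict Implicit.
Unset Printing Implicit Defensive.

Import Order.TTheory GRing.Theory Num.Theory.
Import numFieldNormedType.Exports.

Local Open Scope classical_set_scope.
Local Open Scope complex_scope.
Local Open Scope ring_scope.

(* The bare type [R[i]] carries no canonical topology; packed as a
   [numClosedFieldType] it inherits the topology of its own norm, and the
   structure of normed module over itself, so that [derivable] below means
   complex differentiability. *)
Definition Cx (R : realType) : numClosedFieldType := R[i].

Definition toC (R : realType) (x : R) : Cx R := x%:C.

Definition expC (R : realType) (z : Cx R) : Cx R :=
  limn (series (fun n : nat => z ^+ n / n`!%:R)).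

(* Euler's integral; the value is meaningful for [0 < x] only. *)
Definition Gamma (R : realType) (x : R) : R :=
  \int[@lebesgue_measure R]_(t in `]0, +oo[) (t `^ (x - 1) * expR (- t)).

Definition entire (R : realType) (w : Cx R -> Cx R) : Prop :=
  forall z, derivable w z 1.

Definition real_entire (R : realType) (w : Cx R -> Cx R) : Prop :=
  entire w /\ forall x : R, w (toC x) \is Num.real.

(* [p z = \prod_k (1 + z / z_k)] with [z_k > 0] and [\sum_k 1 / z_k < oo]; the
   first case is that of finitely many (possibly no) factors, the second one
   that of infinitely many. *)
Definition is_genus0_product (R : realType) (p : Cx R -> Cx R) : Prop :=
  (exists2 zs : seq R, {in zs, forall x, 0 < x} &
     forall z, p z = \prod_(x <- zs) (1 + z / toC x))
  \/
  (exists zs : nat -> R,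
     [/\ forall k, 0 < zs k,
         cvgn (series (fun k => (zs k)^-1)) &
         forall z, (fun n : nat => \prod_(k < n) (1 + z / toC (zs k))) @ \oo
                     --> p z]).

Definition LPI_form (R : realType) (w : Cx R -> Cx R) : Prop :=
  exists (c : R) (m : nat) (sigma : R) (p : Cx R -> Cx R),
    [/\ 0 <= sigma, is_genus0_product p &
        forall z, w z = toC c * z ^+ m * expC (toC sigma * z) * p z].

Definition LPI (R : realType) (w : Cx R -> Cx R) : Prop :=
  real_entire w /\ (LPI_form w \/ LPI_form (fun z => w (- z))).

Definition LPplus (R : realType) (phi : Cx R -> Cx R) : Prop :=
  LPI phi /\
  exists2 gamma : nat -> R, (forall k, 0 <= gamma k) &
    forall z, series (fun k => toC (gamma k) * (z ^+ k / k`!%:R)) @ \oo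
                --> phi z.

(* The ring power satisfies [0 ^+ 0 = 1]. *)
Definition eta (R : realType) (s : nat) (z : Cx R) : Cx R :=
  limn (series (fun n : nat =>
    toC (n%:R ^+ s / Gamma (n%:R + 1)) * (z ^+ n / n`!%:R))).

(* Main.v *)
From HB Require Import structures.
Require Import Defs.
From mathcomp Require Import all_boot all_order all_algebra.
From mathcomp Require Import all_classical all_reals all_analysis.
From mathcomp Require Import measurable_realfun complex ring lra.

(* With [theta p = z p'], [eta_s = theta^s eta_0] is the limit, as [N -> oo],
   of the polynomials
     [sum_n n^s C(N, n) / (n! N^n) z^n
        = (N! N^N)^-1 theta^s ((1 + N d/dz)^N z^N)].
   If all the roots [r_i] of [p] are real, so are those of [a p + b p'] for real
   [a], [b], because [p' / p = sum_i (z - r_i)^-1] has a nonzero imaginary part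
   off the real line. Hence the approximants are real-rooted, and having
   nonnegative coefficients they are of the form [z^m prod_k (1 + a_{N,k} z)]
   with [a_{N,k} > 0] and [sum_k a_{N,k}] bounded. Order the [a_{N,k}]
   decreasingly in [k], so that [a_{N,k} <= A / (k + 1)], and let [a_k] be the
   limit of [a_{N,k}] along an ultrafilter in [N]. The factors with [k < K]
   converge, and the others are within [O(1 / K)] of
   [exp (z sum_{k >= K} a_{N,k})], uniformly in [N]. As [K -> oo], the limit
   is [z^m e^{sigma z} prod_k (1 + a_k z)] with
   [sigma = lim_N sum_k a_{N,k} - sum_k a_k >= 0]. *)

Set Implicit Arguments.
Unset Strict Implicit.
Unset Printing Implicit Defensive.

Import Order.TTheory GRing.Theory Num.Theory.
Import numFieldNormedType.Exports.

Local Open Scope classical_set_scope.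
Local Open Scope complex_scope.
Local Open Scope ring_scope.

(** * Complex numbers over a realType *)

Section ComplexBasics.
Variable R : realType.
Implicit Types (x y : R) (z w : Cx R).

HB.instance Definition _ := GRing.RMorphism.copy (@toC R) (real_complex R).

(** The norm of [Cx R] takes its values in [Cx R] itself; [cabs] is the same modulus as an element
    of [R], so that it can be compared with real series and limits. *)
Definition cabs z : R := complex.Re `|z|.

Lemma toC_cabs z : toC (cabs z) = `|z|.
Proof. by rewrite /toC /cabs; apply: RRe_real; exact: normr_real. Qed.

Lemma le_toC x y : (toC x <= toC y) = (x <= y).
Proof. exact: lecR. Qed.

Lemma lt_toC x y : (toC x < toC y) = (x < y).
Proof. exact: ltcR. Qed.

Lemma toC_inj : injective (@toC R).
Proof. exact: complexI. Qed.

Lemma cabs_ge0 z : 0 <= cabs z.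
Proof. by rewrite -le_toC toC_cabs rmorph0. Qed.

Lemma cabsM z w : cabs (z * w) = cabs z * cabs w.
Proof. by apply: toC_inj; rewrite rmorphM/= !toC_cabs normrM. Qed.

Lemma cabsX z n : cabs (z ^+ n) = cabs z ^+ n.
Proof. by apply: toC_inj; rewrite rmorphXn/= !toC_cabs normrX. Qed.

Lemma cabsV z : cabs z^-1 = (cabs z)^-1.
Proof. by apply: toC_inj; rewrite fmorphV/= !toC_cabs normfV. Qed.

Lemma ler_cabsD z w : cabs (z + w) <= cabs z + cabs w.
Proof. by rewrite -le_toC rmorphD/= !toC_cabs ler_normD. Qed.

Lemma cabsB z w : cabs (z - w) = cabs (w - z).
Proof. by rewrite /cabs distrC. Qed.

Lemma ler_cabsB z w : `|cabs z - cabs w| <= cabs (z - w).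
Proof.
have H a b : cabs a - cabs b <= cabs (a - b).
  by rewrite lerBlDr (le_trans _ (ler_cabsD _ _))// subrK.
by rewrite ler_norml H lerNl opprB cabsB H.
Qed.

Lemma cabs_toC x : cabs (toC x) = `|x|.
Proof.
by apply: toC_inj; rewrite toC_cabs /toC normc_def/= expr0n/= addr0 sqrtr_sqr.
Qed.

Lemma cabs0 : cabs 0 = 0.
Proof. by rewrite /cabs normr0. Qed.

Lemma cabs1 : cabs 1 = 1.
Proof. by rewrite /cabs normr1. Qed.

Lemma cabs_nat n : cabs n%:R = n%:R.
Proof. by rewrite -(rmorph_nat (@toC R)) cabs_toC normr_nat. Qed.

Lemma ler_cabs_sum (I : Type) (r : seq I) (P : pred I) (F : I -> Cx R) :
  cabs (\sum_(i <- r | P i) F i) <= \sum_(i <- r | P i) cabs (F i).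
Proof.
rewrite -le_toC toC_cabs rmorph_sum/=.
by under [leRHS]eq_bigr do rewrite toC_cabs; exact: ler_norm_sum.

Qed.

Lemma cabsi : cabs 'i%C = 1.
Proof.
by apply: toC_inj; rewrite toC_cabs normc_def/= expr0n/= add0r expr1n sqrtr1.
Qed.

Lemma ler_cabs_ReIm z : cabs z <= `|complex.Re z| + `|complex.Im z|.
Proof.
rewrite {1}[z]complexE (le_trans (ler_cabsD _ _))// cabsM.
rewrite -!/(toC _) !cabs_toC lerD2l.
by rewrite cabsi mul1r.
Qed.

Section Filter.
Variables (T : Type) (F : set_system T).
Context {FF : Filter F}.

Lemma cvgC_squeeze (u : T -> Cx R) (l : Cx R) (e : T -> R) :
  (\forall t \near F, cabs (u t - l) <= e t) -> e @ F --> (0 : R) ->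
  u @ F --> l.
Proof.
move=> ue e0; apply/cvgrPdist_lt => /= eps eps0.
have epsE : toC (complex.Re eps) = eps by apply: RRe_real; exact: gtr0_real.
rewrite -epsE -(rmorph0 (@toC R)) lt_toC in eps0 *.
move/cvgrPdist_lt : e0 => /(_ _ eps0); apply: filterS2 ue => t ue.
rewrite sub0r normrN -toC_cabs lt_toC cabsB; apply: le_lt_trans.
exact: (le_trans ue (ler_norm _)).
Qed.

Lemma cvg_cabs_sub (u : T -> Cx R) (l : Cx R) :
  u @ F --> l -> cabs (u t - l) @[t --> F] --> (0 : R).
Proof.
move=> /cvgrPdist_lt ul; apply/cvgrPdist_lt => /= eps eps0.
have /ul : 0 < toC eps by rewrite -(rmorph0 (@toC R)) lt_toC.
apply: filterS => t; rewrite -toC_cabs lt_toC cabsB sub0r normrN.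
by rewrite ger0_norm ?cabs_ge0.
Qed.

Lemma cvg_cabs (u : T -> Cx R) (l : Cx R) :
  u @ F --> l -> cabs (u t) @[t --> F] --> cabs l.
Proof.
move=> /cvg_cabs_sub/cvgrPdist_lt ul; apply/cvgrPdist_lt => /= eps eps0.
apply: filterS (ul _ eps0) => t.
rewrite sub0r normrN ger0_norm ?cabs_ge0// distrC; apply: le_lt_trans.
exact: ler_cabsB.
Qed.

Lemma cvg_toC (u : T -> R) (l : R) :
  u @ F --> l -> toC (u t) @[t --> F] --> toC l.
Proof.
move=> ul; apply: (@cvgC_squeeze _ _ (fun t => `|u t - l|)).
  by apply: nearW => t; rewrite -rmorphB cabs_toC.
rewrite -(normr0 R) -(subrr l); apply: cvg_norm.
by apply: cvgB => //; exact: cvg_cst.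
Qed.

End Filter.

(** The real and imaginary parts are series of reals dominated by [v], hence convergent; their
    limits are reassembled into a complex one. *)
Lemma is_cvg_seriesC (u : nat -> Cx R) (v : R ^nat) :
  (forall n, cabs (u n) <= v n) -> cvgn (series v) -> cvgn (series u).
Proof.
move=> uv cv.
have cmp (g : Cx R -> R) : (forall z, `|g z| <= cabs z) ->
    cvgn (series (g \o u)).
  move=> gle; apply: normed_cvg; apply: series_le_cvg cv => n //=.
    exact: le_trans (cabs_ge0 _) (uv n).
  exact: le_trans (gle _) (uv n).
have cRe : cvgn (series ((@complex.Re R : Cx R -> R) \o u)).
  apply: cmp => z; rewrite -le_toC toC_cabs; exact: normc_ge_Re.
have cIm : cvgn (series ((@complex.Im R : Cx R -> R) \o u)).
  apply: cmp => z; rewrite -le_toC toC_cabs.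
  (* The bound on the imaginary part comes from the one on the real part, since the real part of
     [z 'i] is minus the imaginary part of [z]. *)
  have := normc_ge_Re (z * 'i%C); rewrite ReiNIm normrN normrM => h.
  by apply: (le_trans h); rewrite ler_piMr// -toC_cabs cabsi.
have sRe n : complex.Re (series u n) =
    series ((@complex.Re R : Cx R -> R) \o u) n.
  by rewrite /series/= (raddf_sum (@complex.Re R : Rcomplex R -> R)).
have sIm n : complex.Im (series u n) =
    series ((@complex.Im R : Cx R -> R) \o u) n.
  by rewrite /series/= (raddf_sum (@complex.Im R : Rcomplex R -> R)).
set a := limn (series ((@complex.Re R : Cx R -> R) \o u)) in cRe.
set b := limn (series ((@complex.Im R : Cx R -> R) \o u)) in cIm.
apply/cvg_ex; exists ((a +i* b)%C : Cx R).
apply: (@cvgC_squeeze _ _ _ _ _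
  (fun n => `|series ((@complex.Re R : Cx R -> R) \o u) n - a|
            + `|series ((@complex.Im R : Cx R -> R) \o u) n - b|)).
  apply: nearW => n; rewrite (le_trans (ler_cabs_ReIm _))//.
  by rewrite -sRe -sIm; case: (series u n).
rewrite -(addr0 0); apply: cvgD.
- rewrite -(normr0 R) -(subrr a); apply: cvg_norm.
  by apply: cvgB => //; exact: cvg_cst.
- rewrite -(normr0 R) -(subrr b); apply: cvg_norm.
  by apply: cvgB => //; exact: cvg_cst.
Qed.

Lemma cabs_lim_le (u : nat -> Cx R) (l : Cx R) (v : R ^nat) (m : R) :
  u @ \oo --> l -> v @ \oo --> m ->
  (\forall n \near \oo, cabs (u n) <= v n) -> cabs l <= m.
Proof.
move=> /cvg_cabs ul vm uv; rewrite -(cvg_lim _ ul)// -(cvg_lim _ vm)//.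
by apply: ler_lim; [exact: cvgP ul|exact: cvgP vm|].
Qed.

End ComplexBasics.

(** * The complex exponential *)

(** The right-hand side runs over the triangle [i + j < N]. Raising [N] by one adds the antidiagonal
    [i + j = N], which is [(x + y)^N / N!] by the binomial theorem. *)
Lemma exp_partial_sumD (K : numFieldType) (x y : K) (N : nat) :
  \sum_(0 <= n < N) (x + y) ^+ n / n`!%:R =
  \sum_(0 <= i < N) x ^+ i / i`!%:R * \sum_(0 <= j < N - i) y ^+ j / j`!%:R.
Proof.
elim: N => [|N IH]; first by rewrite !big_geq.
rewrite big_nat_recr//= IH [RHS]big_nat_recr//=.
rewrite subSnn big_nat1 expr0 fact0 divr1 mulr1.
have -> : \sum_(0 <= i < N) x ^+ i / i`!%:R *
            \sum_(0 <= j < N.+1 - i) y ^+ j / j`!%:R =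
          \sum_(0 <= i < N) (x ^+ i / i`!%:R *
            \sum_(0 <= j < N - i) y ^+ j / j`!%:R +
            x ^+ i / i`!%:R * (y ^+ (N - i) / (N - i)`!%:R)).
  apply: eq_big_nat => i /andP[_ iN].
  by rewrite subSn ?(ltnW iN)// big_nat_recr//= mulrDr.
rewrite big_split/= -addrA; congr (_ + _).
have -> : x ^+ N / N`!%:R = x ^+ N / N`!%:R * (y ^+ (N - N) / (N - N)`!%:R).
  by rewrite subnn expr0 fact0 divr1 mulr1.
rewrite -(@big_nat_recr _ _ _ N 0 (fun i => x ^+ i / i`!%:R *
  (y ^+ (N - i) / (N - i)`!%:R)))//= big_mkord.
rewrite [x + y]addrC exprDn mulr_suml; apply: eq_bigr => -[i/= iN] _.
have f0 k : k`!%:R != 0 :> K by rewrite pnatr_eq0 -lt0n fact_gt0.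
rewrite -(bin_fact (ltnSE iN)) !natrM -mulr_natr.
have b0 : 'C(N, i)%:R != 0 :> K by rewrite pnatr_eq0 -lt0n bin_gt0.
by field; rewrite !f0 b0.
Qed.

Section ComplexExponential.
Variable R : realType.
Implicit Types (x y : R) (z w : Cx R).

Lemma cvg_expC z : series (fun n : nat => z ^+ n / n`!%:R) @ \oo --> expC z.
Proof.
apply: (@is_cvg_seriesC _ _ (exp_coeff (cabs z))); last first.
  exact: is_cvg_series_exp_coeff.
by move=> n; rewrite cabsM cabsX cabsV cabs_nat /exp_coeff.
Qed.

Lemma cvg_expR x : series (fun n : nat => x ^+ n / n`!%:R) @ \oo --> expR x.
Proof. exact: is_cvg_series_exp_coeff. Qed.

Lemma cabs_exp_coeff z n : cabs (z ^+ n / n`!%:R) = cabs z ^+ n / n`!%:R.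
Proof. by rewrite cabsM cabsX cabsV cabs_nat. Qed.

Lemma cabs_expC z : cabs (expC z) <= expR (cabs z).
Proof.
apply: (cabs_lim_le (@cvg_expC z) (@cvg_expR _)); apply: nearW => n.
rewrite (le_trans (ler_cabs_sum _ _ _))//.
by apply: ler_sum => i _; rewrite cabs_exp_coeff.
Qed.

(** The product of the partial sums runs over a square of indices, the partial sum at [z + w] over a
    triangle. The modulus of their difference is at most the same difference formed with [cabs z]
    and [cabs w], which tends to 0 because the real exponential is already known to turn sums into
    products. *)
Lemma expCD z w : expC (z + w) = expC z * expC w.
Proof.
pose D n := series (fun n : nat => (z + w) ^+ n / n`!%:R) n -
  series (fun n : nat => z ^+ n / n`!%:R) n *
  series (fun n : nat => w ^+ n / n`!%:R) n.
pose D' n := series (fun n : nat => cabs z ^+ n / n`!%:R) n *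
  series (fun n : nat => cabs w ^+ n / n`!%:R) n -
  series (fun n : nat => (cabs z + cabs w) ^+ n / n`!%:R) n.
have cD : D @ \oo --> expC (z + w) - expC z * expC w.
  by apply: cvgB; [exact: cvg_expC|apply: cvgM; exact: cvg_expC].
have cD' : D' @ \oo --> (0 : R).
  rewrite -(subrr (expR (cabs z + cabs w))) {1}expRD.
  by apply: cvgB; [apply: cvgM; exact: cvg_expR|exact: cvg_expR].
apply/eqP; rewrite -subr_eq0 -normr_le0 -toC_cabs -(rmorph0 (@toC R)) le_toC.
apply: (cabs_lim_le cD cD'); apply: nearW => n.
have tail (K : numFieldType) (y : K) i :
    \sum_(0 <= j < n) y ^+ j / j`!%:R - \sum_(0 <= j < n - i) y ^+ j / j`!%:R =
    \sum_(n - i <= j < n) y ^+ j / j`!%:R.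
  by rewrite (@big_cat_nat _ _ _ (n - i))//= ?leq_subr// addrAC subrr add0r.
rewrite /D /D' /series/= !exp_partial_sumD cabsB !mulr_suml -!sumrB.
rewrite (le_trans (ler_cabs_sum _ _ _))//; apply: ler_sum => i _.
rewrite -!mulrBr cabsM cabs_exp_coeff ler_wpM2l//.
  by rewrite divr_ge0// exprn_ge0// cabs_ge0.
rewrite !tail.
rewrite (le_trans (ler_cabs_sum _ _ _))//.
by apply: ler_sum => j _; rewrite cabs_exp_coeff.
Qed.

Lemma expC0 : expC (0 : Cx R) = 1.
Proof.
apply: cvg_lim => //; rewrite -cvg_shiftS.
apply: cvg_near_cst; apply: nearW => n.
rewrite /series/= big_nat_recl//= expr0 divr1 big1 ?addr0// => i _.
by rewrite expr0n mul0r.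
Qed.

Lemma expCN z : expC z * expC (- z) = 1.
Proof. by rewrite -expCD subrr expC0. Qed.

Lemma cabs_expC_sub1 z : cabs (expC z - 1) <= cabs z * expR (cabs z).
Proof.
set r := cabs z.
have : cabs (expC z - 1) <= expR r - 1.
  have c1 : series (fun n : nat => z ^+ n / n`!%:R) n - 1 @[n --> \oo]
      --> expC z - 1.
    exact: (cvgB (@cvg_expC z) (cvg_cst _)).
  have c2 : series (fun n : nat => r ^+ n / n`!%:R) n - 1 @[n --> \oo]
      --> expR r - 1.
    exact: (cvgB (@cvg_expR r) (cvg_cst _)).
  apply: (cabs_lim_le c1 c2); exists 1%N => // -[//|n] _ /=.
  rewrite /series/= !big_nat_recl//= !expr0 !divr1 ![1 + _]addrC !addrK.
  rewrite (le_trans (ler_cabs_sum _ _ _))//.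
  by apply: ler_sum => i _; rewrite cabs_exp_coeff.
(* Multiplying [1 - r <= e^{-r}] by [e^r] gives [e^r - 1 <= r e^r]. *)
move=> /le_trans; apply; have := expR_ge1Dx (- r).
rewrite -(ler_pM2r (expR_gt0 r)) -expRD addNr expR0; lra.
Qed.

Lemma cabs_expC_sub1D z :
  cabs (expC z - (1 + z)) <= cabs z ^+ 2 * expR (cabs z).
Proof.
set r := cabs z.
have r0 : 0 <= r by exact: cabs_ge0.
have : cabs (expC z - (1 + z)) <= expR r - (1 + r).
  have c1 : series (fun n : nat => z ^+ n / n`!%:R) n - (1 + z) @[n --> \oo]
      --> expC z - (1 + z).
    exact: (cvgB (@cvg_expC z) (cvg_cst _)).
  have c2 : series (fun n : nat => r ^+ n / n`!%:R) n - (1 + r) @[n --> \oo]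
      --> expR r - (1 + r).
    exact: (cvgB (@cvg_expR r) (cvg_cst _)).
  apply: (cabs_lim_le c1 c2); exists 2%N => // -[//|[//|n]] _ /=.
  rewrite /series/= !big_nat_recl//= !expr0 !expr1 !divr1.
  rewrite !addrA ![1 + _ + _]addrC !addrK.
  rewrite (le_trans (ler_cabs_sum _ _ _))//.
  by apply: ler_sum => i _; rewrite cabs_exp_coeff.
move=> /le_trans; apply; have := expR_ge1Dx (- r).
rewrite -(ler_pM2r (expR_gt0 r)) -expRD addNr expR0 => h.
(* This reads [(1 - r^2) e^r <= 1 + r], that is, [e^r - (1 + r) <= r^2 e^r]. *)
have : (1 + r) * ((1 - r) * expR r) <= 1 + r by rewrite ler_piMr//; lra.
nra.
Qed.

(** Replacing one factor [1 + x z] by [e^{x z}] costs at most [x^2 |z|^2 e^{x |z|}], and the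
    remaining factors are bounded by the corresponding real exponentials. Induction on [l] adds up
    these costs. *)
Lemma prod_near_expC (l : seq R) z : {in l, forall x, 0 <= x} ->
  cabs (expC (toC (\sum_(x <- l) x) * z) - \prod_(x <- l) (1 + toC x * z)) <=
  expR ((\sum_(x <- l) x) * cabs z) * (cabs z ^+ 2 * \sum_(x <- l) x ^+ 2).
Proof.
elim: l => [|b l IH] l0.
  by rewrite !big_nil rmorph0 mul0r expC0 subrr cabs0 mulr0 mulr0.
have b0 : 0 <= b by rewrite l0 ?mem_head.
have {}l0 : {in l, forall x, 0 <= x} by move=> x xl; rewrite l0// inE xl orbT.
have S0 : 0 <= \sum_(x <- l) x by rewrite big_seq sumr_ge0.
have {IH} := IH l0; rewrite !big_cons; move: S0.
set S := \sum_(x <- l) x; set V := \sum_(x <- l) _.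
set P := \prod_(x <- l) _ => S0.
rewrite rmorphD/= [(_ + _) * z]mulrDl [(_ + _) * cabs z]mulrDl.
rewrite expCD expRD => IH.
have splitE (u v t q : Cx R) : u * v - t * q = (u - t) * v + t * (v - q).
  by ring.
rewrite splitE.
have cb : cabs (toC b * z) = b * cabs z by rewrite cabsM cabs_toC ger0_norm.
rewrite (le_trans (ler_cabsD _ _))// !cabsM !mulrDr; apply: lerD.
  rewrite mulrAC; apply: ler_pM; rewrite ?cabs_ge0//.
    by rewrite (le_trans (cabs_expC_sub1D _))// cb exprMn; lra.
  by rewrite (le_trans (cabs_expC _))// ler_expR cabsM cabs_toC ger0_norm.
rewrite -mulrA; apply: ler_pM; rewrite ?cabs_ge0//.
rewrite (le_trans (ler_cabsD _ _))// cabs1 cb; exact: expR_ge1Dx.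
Qed.

End ComplexExponential.

(** * Limits of products with negative zeros *)

(** [K] may exceed the length of [s]: the default [x0] then contributes neutral elements. Lists of
    varying length can thus be treated as sequences padded with zeros. *)
Lemma big_nth_take (T S : Type) (idx : S) (op : Monoid.law idx) (x0 : T)
    (F : T -> S) (s : seq T) (K : nat) : F x0 = idx ->
  \big[op/idx]_(k < K) F (nth x0 s k) = \big[op/idx]_(x <- take K s) F x.
Proof.
move=> F0; elim: s K => [|x s IH] K.
  by rewrite big_nil big1// => i _; rewrite nth_nil.
case: K => [|K]; first by rewrite big_ord0 big_nil.
by rewrite big_ord_recl/= big_cons -IH.
Qed.

(** * Products with coefficients in decreasing order *)

Section SortedProduct.
Variables (R : realType) (s : seq R).
Hypotheses (s_ge0 : {in s, forall x, 0 <= x}) (s_sorted : sorted >=%R s).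

Lemma nth_sorted_ge0 k : 0 <= s`_k.
Proof.
have [ks|ks] := ltnP k (size s); first by rewrite s_ge0// mem_nth.
by rewrite nth_default.
Qed.

Lemma nth_sorted_le i j : (i <= j)%N -> s`_j <= s`_i.
Proof.
move=> ij; have [js|js] := ltnP j (size s); last first.
  by rewrite (nth_default _ js) nth_sorted_ge0.
apply: (@sorted_leq_nth _ >=%R) => //; last exact: leq_ltn_trans js.
- by move=> x y w /= yx xw; exact: le_trans xw yx.
- by move=> x /=.
Qed.

Lemma sum_nth_sorted_le K : \sum_(k < K) s`_k <= \sum_(x <- s) x.
Proof.
rewrite (@big_nth_take _ _ _ _ _ id)//.
rewrite -[in leRHS](cat_take_drop K s) big_cat/= lerDl.
by rewrite big_seq sumr_ge0// => x /mem_drop/s_ge0.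
Qed.

(** The [K + 1] entries of index at most [K] are all at least the last of them. *)
Lemma nth_sorted_bound K : s`_K <= (\sum_(x <- s) x) / K.+1%:R.
Proof.
rewrite ler_pdivlMr ?ltr0n// mulr_natr.
apply: le_trans (sum_nth_sorted_le K.+1).
rewrite -[K.+1 in leLHS]card_ord -sumr_const; apply: ler_sum => i _.
by apply: nth_sorted_le; rewrite -ltnS.
Qed.

(** Only the factors of index at least [K] are replaced by exponentials. The error depends on [s]
    through [B] alone, so it survives a passage to the limit in [s] with [K] fixed. *)
Lemma sorted_prod_near_expC K (z : Cx R) (B : R) : \sum_(x <- s) x <= B ->
  cabs (\prod_(x <- s) (1 + toC x * z) -
        \prod_(k < K) (1 + toC s`_k * z) *
        expC (toC (\sum_(x <- s) x - \sum_(k < K) s`_k) * z)) <=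
  expR (B * cabs z) * (cabs z ^+ 2 * B ^+ 2) / K.+1%:R.
Proof.
set A := \sum_(x <- s) x => AB; set r := cabs z.
have r0 : 0 <= r by exact: cabs_ge0.
have A0 : 0 <= A by rewrite /A big_seq sumr_ge0.
have d0 : {in drop K s, forall x, 0 <= x} by move=> x /mem_drop/s_ge0.
have AE : A = \sum_(k < K) s`_k + \sum_(x <- drop K s) x.
  by rewrite (@big_nth_take _ _ _ _ _ id)// -big_cat/= cat_take_drop.
have -> : A - \sum_(k < K) s`_k = \sum_(x <- drop K s) x.
  by rewrite AE addrAC subrr add0r.
rewrite -[in X in cabs (X - _)](cat_take_drop K s) big_cat/=.
rewrite (@big_nth_take _ _ _ _ _ (fun x => 1 + toC x * z)); last first.
  by rewrite rmorph0 mul0r addr0.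
rewrite -mulrBr cabsM [X in _ * X]cabsB.
have take_le : cabs (\prod_(x <- take K s) (1 + toC x * z)) <=
    expR ((\sum_(x <- take K s) x) * r).
  have : {in take K s, forall x, 0 <= x} by move=> x /mem_take/s_ge0.
  elim: (take K s) => [|x t IH] t0; first by rewrite !big_nil cabs1 mul0r expR0.
  rewrite !big_cons [(_ + _) * r]mulrDl expRD cabsM.
  apply: ler_pM; rewrite ?cabs_ge0//.
    rewrite (le_trans (ler_cabsD _ _))// cabs1 cabsM cabs_toC.
    by rewrite ger0_norm ?t0 ?mem_head// expR_ge1Dx.
  by apply: IH => y yt; rewrite t0// inE yt orbT.
(* Each entry of the tail is at most [A / (K + 1)], so the sum of squares is at most [A / (K + 1)]
   times the sum of the tail. *)
have sq_le : \sum_(x <- drop K s) x ^+ 2 <= B ^+ 2 / K.+1%:R.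
  apply: (@le_trans _ _ (\sum_(x <- drop K s) (A / K.+1%:R) * x)).
    rewrite big_seq [leRHS]big_seq; apply: ler_sum => x xs.
    rewrite expr2 ler_wpM2r ?d0//; apply: le_trans (nth_sorted_bound K).
    by case/(nthP 0): xs => i _ <-; rewrite nth_drop nth_sorted_le// leq_addr.
  rewrite -mulr_sumr mulrAC ler_wpM2r ?invr_ge0// expr2.
  have D0 : 0 <= \sum_(x <- drop K s) x by rewrite big_seq sumr_ge0.
  apply: ler_pM => //; apply: le_trans AB; rewrite [leRHS]AE lerDr.
  by apply: sumr_ge0 => i _; exact: nth_sorted_ge0.
have tail_le := prod_near_expC z d0.
apply: (le_trans (ler_pM (cabs_ge0 _) (cabs_ge0 _) take_le tail_le)).
rewrite [leLHS]mulrA -expRD -mulrDl -/r -big_cat/= cat_take_drop -/A.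
rewrite -[leRHS]mulrA; apply: ler_pM; rewrite ?expR_ge0//.
- by rewrite mulr_ge0 ?exprn_ge0// sumr_ge0// => x _; exact: sqr_ge0.
- by rewrite ler_expR ler_wpM2r.
- by rewrite -mulrA ler_wpM2l// exprn_ge0.
Qed.

End SortedProduct.

(** By compactness of [[a, b]] the image of [G] has a cluster point, and a cluster point of an
    ultrafilter is a limit: a neighbourhood whose preimage is not in [G] would have to meet its own
    complement. *)
Lemma ultra_bounded_cvg (R : realType) (T : Type) (G : set_system T)
    (u : T -> R) (a b : R) : UltraFilter G ->
  (\forall t \near G, a <= u t <= b) -> exists l : R, u @ G --> l.
Proof.
move=> GU uab.
have GP : ProperFilter G by exact: ultra_proper.
have [] := @segment_compact R a b (u @ G).
  by apply: filterS uab => t /= h; rewrite /= in_itv/=.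
move=> l [_ clu]; exists l => V Vl.
have [//|GV] := in_ultra_setVsetC (u @^-1` V) GU.
have [x [nVx Vx]] := clu (~` V) V GV Vl; by [].
Qed.

Section Continuity.
Variables (R : realType) (T : Type) (F : set_system T).
Context {FF : Filter F}.

(** By the addition formula, [e^u - e^w = e^w (e^{u - w} - 1)]. The filter is arbitrary because
    limits are taken both along an ultrafilter and along [\oo]. *)
Lemma cvg_expC_comp (u : T -> Cx R) (w : Cx R) :
  u @ F --> w -> expC (u t) @[t --> F] --> expC w.
Proof.
move=> uw; pose e t := cabs (u t - w).
have e0 : e @ F --> (0 : R) by exact: cvg_cabs_sub.
apply: (@cvgC_squeeze _ _ _ _ _ _
  (fun t => cabs (expC w) * (e t * expR (e t)))).
  apply: nearW => t.
  have -> : expC (u t) - expC w = expC w * (expC (u t - w) - 1).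
    by rewrite mulrBr mulr1 -expCD subrKC.
  by rewrite cabsM ler_wpM2l ?cabs_ge0// cabs_expC_sub1.
rewrite -(mulr0 (cabs (expC w))); apply: cvgM; first exact: cvg_cst.
rewrite -(mul0r (expR 0)); apply: cvgM => //.
by apply: continuous_cvg => //; exact: continuous_expR.
Qed.

Lemma cvg_sum_ord (K : nat) (f : 'I_K -> T -> R) (a : 'I_K -> R) :
  (forall i, f i @ F --> a i) ->
  \sum_(i < K) f i t @[t --> F] --> \sum_(i < K) a i.
Proof. by move=> fa; apply: cvg_big => //; exact: add_continuous. Qed.

Lemma cvg_prod_ord (K : nat) (f : 'I_K -> T -> Cx R) (a : 'I_K -> Cx R) :
  (forall i, f i @ F --> a i) ->
  \prod_(i < K) f i t @[t --> F] --> \prod_(i < K) a i.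
Proof. by move=> fa; apply: cvg_big => //; exact: mul_continuous. Qed.

End Continuity.

(** This turns the value at [z = 1] of a product of factors [1 + x z] into a bound on the sum of the
    [x]. *)
Lemma ge1Dsum_prod (R : realType) (l : seq R) : {in l, forall x, 0 <= x} ->
  1 + \sum_(x <- l) x <= \prod_(x <- l) (1 + x).
Proof.
elim: l => [|x l IH] l0; first by rewrite !big_nil addr0.
have x0 : 0 <= x by rewrite l0 ?mem_head.
have {}l0 : {in l, forall x, 0 <= x} by move=> y yl; rewrite l0// inE yl orbT.
have S0 : 0 <= \sum_(x <- l) x by rewrite big_seq sumr_ge0.
have {IH} := IH l0; rewrite !big_cons; move: S0.
set S := \sum_(x <- l) x; set P := \prod_(x <- l) _ => S0 SP.
nra.
Qed.

Lemma genus0_product_of_nonincreasing (R : realType) (a : R ^nat)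
    (p : Cx R -> Cx R) :
  (forall k, 0 <= a k) -> {homo a : i j / (i <= j)%N >-> j <= i} ->
  cvgn (series a) ->
  (forall z, (fun n : nat => \prod_(k < n) (1 + toC (a k) * z)) @ \oo
    --> p z) ->
  is_genus0_product p.
Proof.
move=> a0 a_noninc ca ap.
have facE x (z : Cx R) : 1 + z / toC x^-1 = 1 + toC x * z.
  by rewrite fmorphV/= invrK mulrC.
(* With [z_k = 1 / a_k], a positive sequence gives an infinite product. If [a] vanishes somewhere,
   it vanishes from its first zero [m] on by monotonicity, and the product has exactly [m]
   factors. *)
have [[K aK0]|apos] := pselect (exists K, a K = 0); last first.
  right; exists (fun k => (a k)^-1); split.
  - move=> k; rewrite invr_gt0 lt_neqAle a0 andbT eq_sym.
    by apply/eqP => ak; apply: apos; exists k.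
  - by under eq_fun do rewrite invrK.
  - move=> z; under eq_fun do under eq_bigr do rewrite facE.
    exact: ap.
have exK : exists n, a n == 0 by exists K; apply/eqP.
case: (ex_minnP exK) => m /eqP am0 minm.
left; exists (mkseq (fun k => (a k)^-1) m).
  move=> x /mapP[k]; rewrite mem_iota/= add0n => km ->.
  rewrite invr_gt0 lt_neqAle a0 andbT eq_sym.
  by apply/negP => /minm; rewrite leqNgt km.
move=> z; rewrite big_map.
have -> : iota 0 m = index_iota 0 m by rewrite /index_iota subn0.
rewrite big_mkord.
under eq_bigr do rewrite facE.
apply: etrans (esym (cvg_lim _ (ap z))) _ => //.
apply: cvg_lim; first exact: norm_hausdorff.
apply: cvg_near_cst; exists m => // n /= mn.
rewrite -(big_mkord xpredT (fun k => 1 + toC (a k) * z)).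
rewrite -[RHS](big_mkord xpredT (fun k => 1 + toC (a k) * z)).
rewrite (@big_cat_nat _ _ _ m)//= [X in _ * X]big1_seq ?mulr1// => k.
rewrite mem_index_iota => /= /andP[mk _].
have -> : a k = 0 by apply/le_anti; rewrite a0 -am0 a_noninc.
by rewrite rmorph0 mul0r addr0.
Qed.

Lemma laguerre_polya_limit (R : realType) (l : nat -> seq R) (f : Cx R -> Cx R) :
  (forall n, {in l n, forall a, 0 <= a}) ->
  (forall z, (fun n => \prod_(a <- l n) (1 + toC a * z)) @ \oo --> f z) ->
  exists sigma (p : Cx R -> Cx R), [/\ 0 <= sigma, is_genus0_product p &
    forall z, f z = expC (toC sigma * z) * p z].
Proof.
move=> l0 lf.
(* Along one ultrafilter finer than [\oo] all the bounded sequences below converge at once, which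
   replaces a diagonal extraction. *)
have [G [GU subG]] := @ultraFilterLemma _ (\oo : set_system nat) _.
have GP : ProperFilter G by exact: ultra_proper.
pose s n := sort >=%R (l n).
have sl n : perm_eq (s n) (l n) by rewrite perm_sort.
have s0 : forall n, {in s n, forall a, 0 <= a}.
  by move=> n a; rewrite mem_sort; exact: l0.
have s_sorted : forall n, sorted >=%R (s n).
  by move=> n; apply: sort_sorted => x y; exact: le_total.
pose A n := \sum_(x <- s n) x.
have A0 n : 0 <= A n by rewrite /A big_seq sumr_ge0// => x /s0.
have Qf z : (fun n => \prod_(a <- s n) (1 + toC a * z)) @ G --> f z.
  move=> V /lf h; apply: (@filterS _ G _ _ _ _ (subG _ h)) => n /=.
  by rewrite (perm_big _ (sl n)).
(* [f 1] is the limit of the products of the [1 + a], each of which is at least [1 + A n]; the added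
   [1] covers the distance to the limit. *)
pose B := cabs (f 1) + 1.
have AB : \forall n \near G, A n <= B.
  have /cvgrPdist_lt/(_ _ ltr01) :
      cabs (\prod_(a <- s n) (1 + toC a * 1) - f 1) @[n --> G] --> (0 : R).
    exact: cvg_cabs_sub.
  apply: filterS => n; rewrite sub0r normrN ger0_norm ?cabs_ge0// => h.
  have -> : A n = 1 + A n - 1 by rewrite addrAC subrr add0r.
  rewrite lerBlDr (le_trans (ge1Dsum_prod (@s0 n)))//.
  have -> : \prod_(a <- s n) (1 + a) = cabs (\prod_(a <- s n) (1 + toC a * 1)).
    have -> : \prod_(a <- s n) (1 + toC a * 1) = toC (\prod_(a <- s n) (1 + a)).
      rewrite rmorph_prod/=; apply: eq_bigr => a _.
      by rewrite rmorphD rmorph1 mulr1.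
    rewrite cabs_toC ger0_norm// big_seq prodr_ge0// => a sa.
    by rewrite addr_ge0// (s0 n).
  have := ler_cabsD (\prod_(a <- s n) (1 + toC a * 1) - f 1) (f 1).
  rewrite subrK /B => h'; lra.
have [AA cA] : exists AA : R, A @ G --> AA.
  apply: (ultra_bounded_cvg (a := 0) (b := B)); apply: filterS AB => n ->.
  by rewrite A0.
have sk0 n k : 0 <= (s n)`_k by exact: nth_sorted_ge0.
have sumsk n K : \sum_(k < K) (s n)`_k <= A n by exact: sum_nth_sorted_le.
have /choice[al cal] : forall k, exists x : R, (s n)`_k @[n --> G] --> x.
  move=> k.
  apply: (ultra_bounded_cvg (a := 0) (b := B)); apply: filterS AB => n AnB.
  rewrite sk0/= (le_trans _ AnB)//; apply: le_trans (sumsk n k.+1).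
  by rewrite big_ord_recr/= lerDr sumr_ge0.
have al0 k : 0 <= al k by apply: cvgr_to_ge (cal k) _; exact: nearW.
have al_noninc : {homo al : i j / (i <= j)%N >-> j <= i}.
  move=> i j ij; apply: ler_cvg_to (cal j) (cal i) _; apply: nearW => n.
  exact: nth_sorted_le.
have csum K : \sum_(k < K) (s n)`_k @[n --> G] --> \sum_(k < K) al k.
  exact: cvg_sum_ord.
have sumal K : series al K <= AA.
  rewrite /series/= big_mkord.
  by apply: ler_cvg_to (csum K) cA _; exact: nearW.
have cser : cvgn (series al).
  apply: nondecreasing_is_cvgn.
    by apply/nondecreasing_seqP => n; rewrite /series/= big_nat_recr//= lerDl.
  by exists AA => _ [n _ <-].
(* [sigma] is the mass that escapes to ever larger indices: the limit of the sums may exceed the sum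
   of the limits. *)
pose sigma := AA - limn (series al).
have sigma0 : 0 <= sigma.
  rewrite subr_ge0; apply: cvgr_to_le cser _; exact: nearW.
(* With this choice the factorization of [f] is immediate, and it remains to show that [p] is the
   limit of the partial products [X z K]. *)
pose p z := f z * expC (- (toC sigma * z)).
pose X z K := \prod_(k < K) (1 + toC (al k) * z).
pose E z K := expC (toC (AA - series al K) * z).
(* The uniform estimate is passed to the limit along [G] with [K] fixed; only afterwards does [K]
   tend to infinity. *)
have est z K : cabs (f z - X z K * E z K) <=
    expR (B * cabs z) * (cabs z ^+ 2 * B ^+ 2) / K.+1%:R.
  have cdiff : \prod_(a <- s n) (1 + toC a * z) -
      \prod_(k < K) (1 + toC (s n)`_k * z) *
      expC (toC (A n - \sum_(k < K) (s n)`_k) * z) @[n --> G] -->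
      f z - X z K * E z K.
    apply: cvgB; first exact: Qf.
    apply: cvgM.
      apply: cvg_prod_ord => i; apply: cvgD; first exact: cvg_cst.
      by apply: cvgM; [apply: cvg_toC|exact: cvg_cst].
    apply: cvg_expC_comp; apply: cvgM; last exact: cvg_cst.
    apply: cvg_toC; apply: cvgB => //; rewrite /series/= big_mkord.
    exact: csum.
  apply: cvgr_to_le (cvg_cabs cdiff) _; apply: filterS AB => n AnB.
  exact: sorted_prod_near_expC.
have cE z : E z @ \oo --> expC (toC sigma * z).
  apply: cvg_expC_comp; apply: cvgM; last exact: cvg_cst.
  by apply: cvg_toC; apply: cvgB; [exact: cvg_cst|exact: cser].
have cXE z : (fun K => X z K * E z K) @ \oo --> f z.
  apply: (@cvgC_squeeze _ _ _ _ _ _ (fun K =>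
    expR (B * cabs z) * (cabs z ^+ 2 * B ^+ 2) / K.+1%:R)).
    by apply: nearW => K; rewrite cabsB.
  rewrite -(mulr0 (expR (B * cabs z) * (cabs z ^+ 2 * B ^+ 2))).
  apply: (@cvgM _ _ _ _ (fun=> _) harmonic); first exact: cvg_cst.
  exact: cvg_harmonic.
exists sigma, p; split => //; last first.
  by move=> z; rewrite /p mulrCA expCN mulr1.
apply: (genus0_product_of_nonincreasing al0 al_noninc cser) => z.
have -> : (fun K => \prod_(k < K) (1 + toC (al k) * z)) =
    (fun K => X z K * E z K * expC (- (toC (AA - series al K) * z))).
  by apply/funext => K; rewrite -mulrA expCN mulr1.
apply: cvgM; first exact: cXE.
apply: cvg_expC_comp; apply: cvgN; apply: cvgM; last exact: cvg_cst.
by apply: cvg_toC; apply: cvgB; [exact: cvg_cst|exact: cser].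
Qed.

(** * Real-rooted polynomials *)

Section RealRootedPolynomials.
Variable C : numClosedFieldType.
Implicit Types (p : {poly C}) (z : C).

(** The zero polynomial is excluded, since every point is a root of it; hence the nonvanishing
    conditions in the closure properties below. *)
Definition real_rooted p := forall z, root p z -> z \is Num.real.

Lemma horner_prod_XsubC (rs : seq C) z :
  (\prod_(r <- rs) ('X - r%:P)).[z] = \prod_(r <- rs) (z - r).
Proof. by rewrite horner_prod; apply: eq_bigr => r _; rewrite hornerXsubC. Qed.

(** The logarithmic derivative, cleared of its denominator. *)
Lemma horner_deriv_prod_XsubC (rs : seq C) z : z \notin rs ->
  (\prod_(r <- rs) ('X - r%:P))^`().[z] =
  (\prod_(r <- rs) (z - r)) * \sum_(r <- rs) (z - r)^-1.
Proof.
elim: rs => [|r rs IH]; first by rewrite !big_nil derivC horner0 mulr0.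
rewrite inE negb_or => /andP[zr zrs]; rewrite !big_cons derivM derivXsubC mul1r.
rewrite hornerD hornerM hornerXsubC IH// horner_prod_XsubC.
by field; rewrite subr_eq0.
Qed.

Lemma real_rooted_combination p (a b : C) :
  a \is Num.real -> b \is Num.real -> real_rooted p ->
  a *: p + b *: p^`() != 0 -> real_rooted (a *: p + b *: p^`()).
Proof.
move=> aR bR pR q0 z qz; apply/negPn/negP => zNR.
have [rs pE] := closed_field_poly_normal p.
set c := lead_coef p in pE.
have c0 : c != 0.
  by apply: contraNneq q0 => c0; rewrite pE c0 !scale0r derivC !scaler0 addr0.
have rsR r : r \in rs -> r \is Num.real.
  by move=> rrs; apply: pR; rewrite pE rootZ// root_prod_XsubC.
have zrs : z \notin rs by apply: contraNN zNR => /rsR.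
have P0 : \prod_(r <- rs) (z - r) != 0.
  rewrite prodf_seq_neq0; apply/allP => r rrs /=; rewrite subr_eq0.
  by apply: contraNneq zNR => ->; exact: rsR.
(* At a nonreal root [z] of [a p + b p'] one may divide by [p(z)], because all the roots of [p] are
   real. *)
have abS : a + b * (\sum_(r <- rs) (z - r)^-1) = 0.
  apply: (mulfI (mulf_neq0 c0 P0)); rewrite mulr0.
  move: qz; rewrite pE derivZ rootE hornerD !hornerZ horner_prod_XsubC.
  rewrite horner_deriv_prod_XsubC// => /eqP h; rewrite -[RHS]h.
  by set S := \sum_(r <- rs) _; set P := \prod_(r <- rs) _; ring.
have Imz : 'Im z != 0 by apply: contraNneq zNR => /Creal_ImP.
(* The inverse of [z - r] is its conjugate over [|z - r|^2]. As [r] is real, all these imaginary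
   parts have the same sign, so they cannot cancel. *)
have ImV r : r \in rs -> 'Im (z - r)^-1 = - 'Im z * `|z - r| ^- 2.
  move=> /rsR rR; rewrite invC_norm [_ * _^*]mulrC ImMr; last first.
    by rewrite rpredV rpredX// normr_real.
  by congr (_ * _); rewrite Im_conj raddfB/= (Creal_ImP _ rR) subr0.
have : b * \sum_(r <- rs) `|z - r| ^- 2 == 0.
  have Imz' : - 'Im z != 0 by rewrite oppr_eq0.
  apply/eqP/(mulfI Imz'); rewrite mulr0 mulrCA mulr_sumr.
  rewrite big_seq; under eq_bigr => r rrs do rewrite -ImV//.
  rewrite -big_seq -raddf_sum/= -ImMl//.
  have := congr1 (@Im C) abS.
  by rewrite raddfD/= (Creal_ImP _ aR) add0r raddf0.
(* Either [b = 0], whence [a = 0]; or a sum of positive terms vanishes, so that [p] has no root and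
   is constant, and again [a = 0]. Both make [a p + b p'] the zero polynomial. *)
rewrite mulf_eq0 => /orP[/eqP b0|].
  move: abS; rewrite b0 mul0r addr0 => a0.
  by rewrite a0 b0 !scale0r addr0 eqxx in q0.
rewrite psumr_eq0; last by move=> r _; rewrite invr_ge0 exprn_ge0.
case: rs => [|r rs] in pE rsR zrs P0 abS ImV *; last first.
  rewrite /= invr_eq0 expf_eq0/= normr_eq0 subr_eq0 => /andP[/eqP zr _].
  by rewrite zr mem_head in zrs.
move=> _; move: abS; rewrite big_nil mulr0 addr0 => a0.
by rewrite pE big_nil a0 scale0r derivZ derivC !scaler0 addr0 eqxx in q0.
Qed.

Lemma real_rooted_deriv p : real_rooted p -> p^`() != 0 -> real_rooted p^`().
Proof.
move=> pR p'0; have := @real_rooted_combination p 0 1 (rpred0 _) (rpred1 _) pR.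
by rewrite scale0r scale1r add0r; exact.
Qed.

(** * The real-rooted approximants and their coefficients *)

Definition theta p := 'X * p^`().

Lemma coef_iter_theta s p n : (iter s theta p)`_n = n%:R ^+ s * p`_n.
Proof.
elim: s => [|s IH]; first by rewrite expr0 mul1r.
rewrite iterS /theta coefXM; case: n IH => [|n] IH /=.
  by rewrite expr0n mul0r.
by rewrite coef_deriv IH -[LHS]mulr_natl mulrA exprS.
Qed.

Lemma real_rooted_theta p : real_rooted p -> p^`() != 0 -> real_rooted (theta p).
Proof.
move=> pR p'0 z; rewrite /theta rootM rootX => /orP[/eqP -> //|].
exact: real_rooted_deriv.
Qed.

(** For [c = k = N] this is [N! N^N L_N(- z / N)], where [L_N] is the Laguerre polynomial of degree
    [N]. *)
Definition laguerre_iter (c : C) N k : {poly C} :=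
  iter k (fun p => p + c *: p^`()) 'X^N.

Lemma coef_laguerre_iter_gt c N k n : (N < n)%N -> (laguerre_iter c N k)`_n = 0.
Proof.
elim: k n => [|k IH] n Nn; first by rewrite /laguerre_iter/= coefXn gtn_eqF.
rewrite /laguerre_iter iterS coefD coefZ coef_deriv -/(laguerre_iter c N k).
by rewrite !IH// ?(ltnW Nn)// ?mul0rn ?mulr0 ?addr0//; exact: ltnW.
Qed.

(** Multiplied by [n!], the coefficients [u_k(n)] satisfy [u_{k+1}(n) = u_k(n) + c u_k(n + 1)],
    which is Pascal's rule weighted by powers of [c]. *)
Lemma coef_laguerre_iter c N k n : (n <= N)%N ->
  (laguerre_iter c N k)`_n * n`!%:R = 'C(k, N - n)%:R * c ^+ (N - n) * N`!%:R.
Proof.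
elim: k n => [|k IH] n nN.
  rewrite /laguerre_iter/= coefXn bin0n subn_eq0.
  have [->|nneq] := eqVneq n N; first by rewrite leqnn subnn expr0 !mul1r.
  by rewrite leqNgt ltn_neqAle nneq nN /= !mul0r.
rewrite /laguerre_iter iterS coefD coefZ coef_deriv -/(laguerre_iter c N k).
have -> : ((laguerre_iter c N k)`_n +
      c * ((laguerre_iter c N k)`_n.+1 *+ n.+1)) * n`!%:R =
    (laguerre_iter c N k)`_n * n`!%:R +
    c * ((laguerre_iter c N k)`_n.+1 * (n.+1)`!%:R).
  by rewrite factS natrM mulrDl -[_ *+ n.+1]mulr_natr; ring.
rewrite IH//; have [nN'|nN'] := ltnP n N; last first.
  have -> : n = N by apply/eqP; rewrite eqn_leq nN.
  by rewrite coef_laguerre_iter_gt// mul0r mulr0 addr0 subnn !bin0.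
rewrite IH// subnS; case: (N - n)%N (subn_gt0 n N) => [|j _ /=].
  by rewrite nN'.
by rewrite binS natrD exprS; ring.
Qed.

Lemma laguerre_iter_neq0 c N k : laguerre_iter c N k != 0.
Proof.
apply/eqP => L0; have := @coef_laguerre_iter c N k N (leqnn N).
rewrite L0 coef0 mul0r subnn bin0 expr0 !mul1r => /esym/eqP.
by rewrite pnatr_eq0 eqn0Ngt fact_gt0.
Qed.

Lemma real_rooted_laguerre_iter c N k :
  c \is Num.real -> real_rooted (laguerre_iter c N k).
Proof.
move=> cR; elim: k => [|k IH].
  move=> z; rewrite /laguerre_iter/= rootE hornerXn expf_eq0 => /andP[_ /eqP->].
  exact: rpred0.
have := @laguerre_iter_neq0 c N k.+1; rewrite /laguerre_iter iterS.
rewrite -/(laguerre_iter c N k) => q0.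
have := @real_rooted_combination (laguerre_iter c N k) 1 c (rpred1 _) cR IH.
by rewrite scale1r; apply.
Qed.

(* For [s > 0] the factor ['X] contributed by the last application of [theta] is
   removed, so that the constant coefficient is [1] in all cases. *)
Lemma real_rooted_laguerre_theta s N : (0 < N)%N ->
  exists2 Q : {poly C}, real_rooted Q & forall n,
    Q`_n = (n + (0 < s))%:R ^+ s * 'C(N, n + (0 < s))%:R /
           ((n + (0 < s))`!%:R * N%:R ^+ (n + (0 < s))).
Proof.
move=> N0; have N0' : N%:R != 0 :> C by rewrite pnatr_eq0 -lt0n.
have f0 k : k`!%:R != 0 :> C by rewrite pnatr_eq0 -lt0n fact_gt0.
pose L := laguerre_iter (N%:R : C) N N.
have NR : (N%:R : C) \is Num.real by exact: realn.
have LR : real_rooted L by exact: real_rooted_laguerre_iter.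
pose d : C := N`!%:R * N%:R ^+ N.
have d0 : d != 0 by rewrite mulf_neq0// expf_neq0.
have LE n : L`_n = d * ('C(N, n)%:R / (n`!%:R * N%:R ^+ n)).
  have [nN|Nn] := leqP n N; last first.
    by rewrite bin_small// mul0r mulr0 coef_laguerre_iter_gt.
  apply: (mulIf (f0 n)); rewrite coef_laguerre_iter// bin_sub// /d.
  have -> : N%:R ^+ N = N%:R ^+ (N - n) * N%:R ^+ n :> C.
    by rewrite -exprD subnK.
  by field; rewrite expf_neq0// f0.
have thetaE t n : (iter t theta L)`_n = n%:R ^+ t * L`_n.
  exact: coef_iter_theta.
(* The coefficient of degree [N - 1] of the derivative is [N] times the leading coefficient of
   [theta^t L], and [N > 0]. *)
have deriv0 t : (iter t theta L)^`() != 0.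
  apply/eqP => D0; have := coef_deriv (iter t theta L) N.-1.
  rewrite D0 coef0 prednK// thetaE LE binn mul1r -[RHS]mulr_natr => /esym/eqP.
  by apply/negP; do ?[apply: mulf_neq0|apply: invr_neq0|apply: expf_neq0].
have thetaR t : real_rooted (iter t theta L).
  by elim: t => [//|t IH]; rewrite iterS; exact: real_rooted_theta.
have scaleR p : real_rooted p -> real_rooted (d^-1 *: p).
  by move=> pR z; rewrite rootZ ?invr_eq0//; exact: pR.
case: s => [|s].
  exists (d^-1 *: L) => [|n]; first exact: scaleR.
  by rewrite coefZ LE addn0 expr0 mul1r mulKf.
(* [theta^(s+1) L] is ['X] times the derivative of [theta^s L], so this derivative is what remains
   once the factor ['X] is removed. *)
exists (d^-1 *: (iter s theta L)^`()) => [|n].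
  by apply: scaleR; exact: real_rooted_deriv.
rewrite coefZ coef_deriv thetaE LE addn1.
rewrite [n.+1%:R ^+ s.+1]exprS -[_ *+ n.+1]mulr_natl.
rewrite -[RHS]mulrA; move: ('C(N, n.+1)%:R / _) (n.+1%:R ^+ s) => x y.
by rewrite (mulrCA y d) (mulrCA _ d) mulKf// mulrA.
Qed.

End RealRootedPolynomials.

(** At a real [r >= 0] the value of [Q] is at least its constant coefficient [1], so every root [r]
    is negative. The factor [z - r] equals [- r (1 + a z)] with [a = - 1 / r], and the constants
    multiply to [Q(0) = 1]. *)
Lemma horner_negative_roots (R : realType) (Q : {poly Cx R}) :
  real_rooted Q -> Q`_0 = 1 -> (forall n, 0 <= Q`_n) ->
  exists2 l : seq R, {in l, forall a, 0 <= a} &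
    forall z, Q.[z] = \prod_(a <- l) (1 + toC a * z).
Proof.
move=> QR Q0 Qge0; have [rs QE] := closed_field_poly_normal Q.
set c := lead_coef Q in QE.
have Qn0 : Q != 0.
  by apply/eqP => h; move/eqP: Q0; rewrite h coef0 eq_sym oner_eq0.
have c0 : c != 0 by rewrite lead_coef_eq0.
have rs_lt0 r : r \in rs -> r < 0.
  move=> rrs; have rQ : root Q r by rewrite QE rootZ// root_prod_XsubC.
  have rR := QR _ rQ; rewrite real_ltNge ?rpred0//; apply/negP => r0.
  have : 1 <= Q.[r].
    rewrite horner_coef; case: (size Q) (size_poly_eq0 Q) => [|n _].
      by rewrite eqxx (negPf Qn0).
    rewrite big_ord_recl/= Q0 expr0 mulr1 lerDl sumr_ge0// => i _.
    by rewrite mulr_ge0// exprn_ge0.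
  by rewrite (rootP rQ) ler10.
have rsE r : r \in rs -> toC (complex.Re (- r^-1)) = - r^-1.
  move=> /rs_lt0 r0; apply: RRe_real; apply: gtr0_real.
  by rewrite oppr_gt0 invr_lt0.
exists [seq complex.Re (- r^-1) | r <- rs].
  move=> a /mapP[r rrs ->]; rewrite -le_toC rsE// rmorph0.
  by rewrite oppr_ge0 invr_le0 ltW// rs_lt0.
have prodE z : Q.[z] = c * \prod_(r <- rs) (z - r).
  by rewrite [in LHS]QE hornerZ horner_prod_XsubC.
have c1 : c * \prod_(r <- rs) (- r) = 1.
  rewrite -[RHS]Q0 -horner_coef0 prodE; congr (c * _).
  by apply: eq_bigr => r _; rewrite sub0r.
move=> z; rewrite prodE big_map -[RHS]mul1r -[X in _ = X * _]c1.
rewrite -mulrA -big_split/=; congr (c * _).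
rewrite big_seq [RHS]big_seq; apply: eq_bigr => r rrs; rewrite rsE//.
have r0 : r != 0 by rewrite lt_eqF// rs_lt0.
by field.
Qed.

(** * The Gamma function at positive integers *)

Section GammaNat.
Variable R : realType.
Implicit Types (t x : R) (n : nat).

(** Repeated integration by parts of [t^n e^{-t}], with no constant added, so that the primitive
    tends to 0 at infinity. *)
Fixpoint gamma_primitive n t : R :=
  if n is m.+1 then - (t ^+ m.+1 * expR (- t)) + m.+1%:R * gamma_primitive m t
  else - expR (- t).

Lemma is_derive_gamma_primitive n t :
  is_derive t (1 : R) (gamma_primitive n) (t ^+ n * expR (- t)).
Proof.
have dE : is_derive t (1 : R) (fun u : R => expR (- u)) (- expR (- t)).
  by apply: is_derive_eq; rewrite mulrN1.
elim: n => [|n IH] /=.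
  by apply: is_derive_eq; rewrite opprK mul1r.
have dX : is_derive t (1 : R) (fun u : R => u ^+ n.+1) (n.+1%:R * t ^+ n).
  apply: DeriveDef; first exact: exprn_derivable.
  by rewrite exp_derive /GRing.scale/= mulr1.
have := is_deriveD (is_deriveN (is_deriveM dX dE)) (is_deriveZ n.+1%:R IH).
move=> H. apply: (is_derive_eq H).
rewrite /GRing.scale/= exprS; ring.
Qed.

(** From [e^t >= t^(n+1) / (n+1)!] the function is at most [(n+1)! / t]. *)
Lemma cvgr_exprn_expR n : t ^+ n * expR (- t) @[t --> +oo] --> (0 : R).
Proof.
have cV : (n.+1)`!%:R * t^-1 @[t --> +oo] --> (0 : R).
  rewrite -(mulr0 (n.+1)`!%:R); apply: cvgM; first exact: cvg_cst.
  by apply/(@gtr0_cvgV0 _ _ _ _ id); [exact: nbhs_pinfty_gt|exact: cvg_id].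
apply: (squeeze_cvgr _ (cvg_cst 0) cV); near=> t.
have t0 : 0 < t by near: t; exact: nbhs_pinfty_gt.
rewrite mulr_ge0 ?exprn_ge0 ?expR_ge0 ?(ltW t0)//=.
rewrite expRN ler_pdivrMr ?expR_gt0// mulrAC ler_pdivlMr// -exprSr.
rewrite mulrC -ler_pdivrMr ?ltr0n ?fact_gt0//.
by apply: le_trans (expR_ge1Dxn n (ltW t0)); rewrite lerDr.
Unshelve. all: by end_near. Qed.

Lemma cvgr_gamma_primitive n : gamma_primitive n t @[t --> +oo] --> (0 : R).
Proof.
elim: n => [|n IH] /=; first by rewrite -oppr0; apply: cvgN; exact: cvgr_expR.
rewrite -(addr0 0) -[X in X + _]oppr0 -[X in _ + X](mulr0 n.+1%:R).
apply: cvgD; first by apply: cvgN; exact: cvgr_exprn_expR.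
by apply: cvgM => //; exact: cvg_cst.
Qed.

Lemma gamma_primitive0 n : gamma_primitive n 0 = - n`!%:R.
Proof.
elim: n => [|n IH] /=; first by rewrite oppr0 expR0.
by rewrite IH expr0n mul0r oppr0 add0r mulrN -natrM factS.
Qed.

Lemma Gamma_nat n : Gamma (n%:R + 1) = n`!%:R :> R.
Proof.
have cf : continuous (fun t => t ^+ n * expR (- t) : R).
  move=> t; apply: cvgM; first exact: exprn_continuous.
  apply: (@continuous_comp _ _ _ -%R expR); first exact: opp_continuous.
  exact: continuous_expR.
have cF : continuous (gamma_primitive n).
  move=> t; apply/differentiable_continuous/derivable1_diffP.
  exact: (@ex_derive _ _ _ _ _ _ _ (is_derive_gamma_primitive n t)).
rewrite /Gamma addrK /Rintegral.
under eq_integral => t.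
  rewrite inE/= in_itv/= andbT => t0; rewrite powR_mulrn ?(ltW t0)//; over.
(* The fundamental theorem of calculus is applied on [[0, +oo[]; adding the endpoint does not change
   the integral. *)
rewrite integral_itv_obnd_cbnd; last first.
  apply/measurable_EFinP/measurable_funTS; exact: continuous_measurable_fun.
rewrite (ge0_continuous_FTC2y _ _ (cvgr_gamma_primitive n))/=.
- by rewrite gamma_primitive0 sub0r opprK.
- by move=> x x0; rewrite mulr_ge0 ?exprn_ge0 ?expR_ge0.
- by apply: continuous_subspaceT.
- move=> x _.
  exact: (@ex_derive _ _ _ _ _ _ _ (is_derive_gamma_primitive n x)).
- by apply: cvg_at_right_filter; exact: cF.
- move=> x _; rewrite derive1E.
  exact: (@derive_val _ _ _ _ _ _ _ (is_derive_gamma_primitive n x)).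
Qed.

End GammaNat.

(** * Entire power series *)

Section PowerSeries.
Variable R : realType.
Implicit Types (z h : Cx R) (r : R).

Lemma cabs_exprD_sub z h n : cabs h <= 1 ->
  cabs ((z + h) ^+ n - z ^+ n) <= cabs h * (cabs z + 1) ^+ n.
Proof.
move=> h1; elim: n => [|n IH].
  by rewrite !expr0 subrr cabs0 mulr1 cabs_ge0.
have -> : (z + h) ^+ n.+1 - z ^+ n.+1 =
    z * ((z + h) ^+ n - z ^+ n) + h * (z + h) ^+ n by rewrite !exprS; ring.
rewrite (le_trans (ler_cabsD _ _))// !cabsM cabsX exprS.
have -> : cabs h * ((cabs z + 1) * (cabs z + 1) ^+ n) =
  cabs z * (cabs h * (cabs z + 1) ^+ n) + cabs h * (cabs z + 1) ^+ n by ring.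
apply: lerD; rewrite ler_wpM2l ?cabs_ge0//; apply: lerXn2r.
- by rewrite nnegrE cabs_ge0.
- by rewrite nnegrE addr_ge0// cabs_ge0.
- by rewrite (le_trans (ler_cabsD _ _))// lerD2l.
Qed.

(** A second-order Taylor bound without factors polynomial in [n]: summed against the coefficients
    of a power series, it requires convergence at the radius [|z| + 1] only. *)
Lemma cabs_exprD_sub_deriv z h n : cabs h <= 1 ->
  cabs ((z + h) ^+ n - z ^+ n - h * (n%:R * z ^+ n.-1)) <=
  cabs h ^+ 2 * (cabs z + 1) ^+ n.
Proof.
move=> h1; elim: n => [|n IH].
  by rewrite !expr0 subrr mul0r mulr0 subrr cabs0 mulr1 exprn_ge0 ?cabs_ge0.
have -> : (z + h) ^+ n.+1 - z ^+ n.+1 - h * (n.+1%:R * z ^+ n.+1.-1) =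
    z * ((z + h) ^+ n - z ^+ n - h * (n%:R * z ^+ n.-1)) +
    h * ((z + h) ^+ n - z ^+ n).
  rewrite /=; case: n {IH} => [|n] /=; first by rewrite !expr0 !expr1; ring.
  by rewrite !exprS; ring.
rewrite (le_trans (ler_cabsD _ _))// !cabsM [(cabs z + 1) ^+ _]exprS.
have -> : cabs h ^+ 2 * ((cabs z + 1) * (cabs z + 1) ^+ n) =
  cabs z * (cabs h ^+ 2 * (cabs z + 1) ^+ n) +
  cabs h * (cabs h * (cabs z + 1) ^+ n) by ring.
by apply: lerD; rewrite ler_wpM2l ?cabs_ge0// cabs_exprD_sub.
Qed.

(** The left-hand side is one term of the binomial expansion; this dominates the termwise derivative
    of a power series. *)
Lemma natM_exprn_pred_le r n : 0 <= r -> n%:R * r ^+ n.-1 <= (r + 1) ^+ n.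
Proof.
move=> r0; elim: n => [|n IH]; first by rewrite mul0r expr0.
rewrite exprS [leRHS]mulrDl mul1r -natr1 mulrDl mul1r /=; apply: lerD.
  apply: le_trans (ler_wpM2l r0 IH); rewrite mulrCA.
  by case: n {IH} => [|n]; rewrite ?mul0r//= -exprS.
by apply: lerXn2r; rewrite ?nnegrE ?addr_ge0// lerDl.
Qed.

Variables (c : R ^nat) (f : Cx R -> Cx R).
Hypothesis c_ge0 : forall n, 0 <= c n.
Hypothesis cvg_c : forall r, 0 <= r -> cvgn (series (fun n => c n * r ^+ n)).
Hypothesis cvg_f : forall z, series (fun n => toC (c n) * z ^+ n) @ \oo --> f z.

(** Let [g] be the sum of the termwise derivatives and [S] the sum of [c_n (|z| + 1)^n]. Adding up
    the second-order bounds shows that the difference quotient is within [|h| S] of [g]. *)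
Lemma power_series_entire : entire f.
Proof.
move=> z; set r := cabs z + 1.
have r0 : 0 <= r by rewrite addr_ge0// cabs_ge0.
have r1 : 1 <= r by rewrite lerDr cabs_ge0.
have [g cg] : exists g : Cx R,
    series (fun n => toC (c n) * (n%:R * z ^+ n.-1)) @ \oo --> g.
  apply/cvg_ex.
  apply: (is_cvg_seriesC _ (cvg_c r0)) => n.
  rewrite !cabsM cabs_toC ger0_norm// cabsX cabs_nat ler_wpM2l//.
  exact: natM_exprn_pred_le (cabs_ge0 z).
have cS := cvg_c r0; set S := limn _ in cS.
have S0 : 0 <= S.
  apply: limr_ge cS _; apply: nearW => n.
  by apply: sumr_ge0 => i _; rewrite mulr_ge0 ?exprn_ge0.
have key h : cabs h <= 1 -> cabs (f (z + h) - f z - h * g) <= cabs h ^+ 2 * S.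
  move=> h1.
  have c1 : series (fun n => toC (c n) * (z + h) ^+ n) n -
      series (fun n => toC (c n) * z ^+ n) n -
      h * series (fun n => toC (c n) * (n%:R * z ^+ n.-1)) n @[n --> \oo] -->
      f (z + h) - f z - h * g.
    apply: cvgB; first by apply: cvgB; exact: cvg_f.
    by apply: cvgM; [exact: cvg_cst|exact: cg].
  have c2 : cabs h ^+ 2 * series (fun n => c n * r ^+ n) n @[n --> \oo] -->
      cabs h ^+ 2 * S.
    by apply: cvgM; [exact: cvg_cst|exact: cS].
  apply: (cabs_lim_le c1 c2); apply: nearW => n.
  rewrite /series/= !mulr_sumr -!sumrB (le_trans (ler_cabs_sum _ _ _))//.
  apply: ler_sum => i _.
  have -> : toC (c i) * (z + h) ^+ i - toC (c i) * z ^+ i -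
      h * (toC (c i) * (i%:R * z ^+ i.-1)) =
      toC (c i) * ((z + h) ^+ i - z ^+ i - h * (i%:R * z ^+ i.-1)) by ring.
  rewrite cabsM cabs_toC ger0_norm// [leRHS]mulrCA ler_wpM2l//.
  exact: cabs_exprD_sub_deriv.
apply/cvg_ex; exists g.
apply: (@cvgC_squeeze _ _ _ _ _ _ (fun h : Cx R => cabs h * S)); last first.
  rewrite -(mul0r S); apply: cvgM; last exact: cvg_cst.
  rewrite -(cabs0 R); apply: cvg_cabs; exact: nbhs_dnbhs.
near=> h.
have h0 : h != 0 by near: h; exact: nbhs_dnbhs_neq.
have h1 : cabs h <= 1.
  by rewrite -le_toC toC_cabs rmorph1; near: h; exact: dnbhs0_le.
have ch0 : 0 < cabs h.
  by rewrite -lt_toC toC_cabs rmorph0 normr_gt0.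
have -> : h^-1 *: (f (h *: 1 + z) - f z) - g = h^-1 * (f (z + h) - f z - h * g).
  by rewrite /GRing.scale/= mulr1 [h + z]addrC [RHS]mulrBr mulKf.
rewrite cabsM cabsV mulrC ler_pdivrMr// (le_trans (key _ h1))//.
by rewrite expr2 [leRHS]mulrAC.
Unshelve. all: by end_near. Qed.

End PowerSeries.

(** * The functions eta_s *)

Section Eta.
Variable R : realType.
Implicit Types (s n N : nat) (r : R) (z : Cx R).

Definition eta_coef s n : R := n%:R ^+ s / n`!%:R ^+ 2.

Lemma eta_coef_ge0 s n : 0 <= eta_coef s n.
Proof. by rewrite divr_ge0 ?exprn_ge0. Qed.

(** [n^s / s!] is one term of the exponential series of [n]. *)
Lemma exprn_le_fact_expR s n : (n%:R : R) ^+ s <= s`!%:R * expR 1 ^+ n.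
Proof.
rewrite -expRM_natl mulr1 mulrC -ler_pdivrMr ?ltr0n ?fact_gt0//.
case: s => [|s].
  by rewrite expr0 divr1 (le_trans _ (expR_ge1Dx _))// lerDl.
by apply: le_trans (expR_ge1Dxn s (ler0n _ n)); rewrite lerDr.
Qed.

(** One of the two factorials is bounded below by [1] and [n^s] by [s! e^n] above, which leaves [s!]
    times the exponential series at [e r]. *)
Lemma is_cvg_eta_coef s r : 0 <= r ->
  cvgn (series (fun n => eta_coef s n * r ^+ n)).
Proof.
move=> r0; apply: (@series_le_cvg _ _ (s`!%:R *: exp_coeff (expR 1 * r))).
- by move=> n; rewrite mulr_ge0 ?eta_coef_ge0 ?exprn_ge0.
- move=> n; rewrite mulr_ge0// mulr_ge0 ?invr_ge0// exprn_ge0//.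
  by rewrite mulr_ge0 ?expR_ge0.
- move=> n; rewrite /eta_coef.
  have f1 : 1 <= n`!%:R :> R by rewrite ler1n fact_gt0.
  have f0 : 0 < n`!%:R :> R by rewrite ltr0n fact_gt0.
  have -> : (s`!%:R *: exp_coeff (expR 1 * r)) n =
      (s`!%:R * expR 1 ^+ n) / n`!%:R * r ^+ n.
    by rewrite fctE /exp_coeff/= exprMn /GRing.scale/=; ring.
  rewrite ler_wpM2r ?exprn_ge0//.
  apply: ler_pM; rewrite ?exprn_ge0 ?invr_ge0 ?exprn_ge0//.
    exact: exprn_le_fact_expR.
  by rewrite lef_pV2 ?posrE ?exprn_gt0// expr2 ler_peMr// ltW.
- by apply: is_cvg_seriesZ; exact: is_cvg_series_exp_coeff.
Qed.

Lemma eta_termE s z :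
  (fun n => toC (n%:R ^+ s / Gamma (n%:R + 1)) * (z ^+ n / n`!%:R)) =
  (fun n => toC (eta_coef s n) * z ^+ n).
Proof.
apply/funext => n; rewrite Gamma_nat /eta_coef !rmorphM/= !fmorphV/=.
rewrite !rmorphXn/= !rmorph_nat.
by rewrite expr2 invfM; ring.
Qed.

Lemma cvg_eta s z :
  series (fun n => toC (eta_coef s n) * z ^+ n) @ \oo --> eta s z.
Proof.
rewrite /eta eta_termE.
apply: (is_cvg_seriesC _ (@is_cvg_eta_coef s _ (cabs_ge0 z))) => n.
by rewrite cabsM cabsX cabs_toC ger0_norm ?eta_coef_ge0.
Qed.

(** The ratio is the product of [1 - j / N] over [j < n] when [n <= N], and 0 beyond. Each factor
    lowers it by at most [j / N], and the sum of the [j < n] is at most [n^2]. *)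
Lemma ffact_ratio_bounds N n : (0 < N)%N ->
  1 - n%:R ^+ 2 / N%:R <= ((N ^_ n)%:R / N%:R ^+ n : R) <= 1.
Proof.
move=> N0; have N0' : 0 < N%:R :> R by rewrite ltr0n.
elim: n => [|n /andP[IH1 IH2]].
  by rewrite ffactn0 expr0 !expr0n mul0r subr0 divr1 lexx.
set x := (N ^_ n)%:R / N%:R ^+ n in IH1 IH2.
have x0 : 0 <= x by rewrite divr_ge0 ?exprn_ge0.
have -> : (N ^_ n.+1)%:R / N%:R ^+ n.+1 = x * ((N - n)%:R / N%:R) :> R.
  by rewrite ffactnSr natrM exprSr invfM /x; ring.
have y1 : (N - n)%:R / N%:R <= 1 :> R.
  by rewrite ler_pdivrMr// mul1r ler_nat leq_subr.
(* Only an inequality, since the subtraction in [nat] is truncated: for [n > N] the left-hand side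
   is negative and the right-hand side is 0. *)
have y2 : 1 - n%:R / N%:R <= (N - n)%:R / N%:R :> R.
  rewrite ler_pdivlMr// mulrBl mul1r divfK ?gt_eqF//.
  by rewrite lerBlDr -natrD ler_nat addnC -leq_subLR.
apply/andP; split; last by rewrite mulr_ile1// divr_ge0.
have a0 : 0 <= n%:R / N%:R :> R by rewrite divr_ge0.
have b0 : 0 <= N%:R^-1 :> R by rewrite invr_ge0.
have h1 : x * (1 - n%:R / N%:R) <= x * ((N - n)%:R / N%:R) by rewrite ler_wpM2l.
rewrite -natr1 sqrrD mulr1 expr1n !mulrDl.
have h2 : x * (n%:R / N%:R) <= n%:R / N%:R by rewrite ler_piMl.
have : (n%:R *+ 2) / N%:R = n%:R / N%:R + n%:R / N%:R :> R.
  by rewrite mulr2n mulrDl.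
lra.
Qed.

(** The ratio tends to 1 as [N] grows, so this form displays the distance to [eta_coef s n];
    [laguerre_coefE] recovers the coefficients of the real-rooted polynomials. *)
Definition laguerre_coef N s n : R := eta_coef s n * ((N ^_ n)%:R / N%:R ^+ n).

Lemma laguerre_coefE N s n : laguerre_coef N s n =
  n%:R ^+ s * 'C(N, n)%:R / (n`!%:R * N%:R ^+ n).
Proof.
have f0 : n`!%:R != 0 :> R by rewrite pnatr_eq0 -lt0n fact_gt0.
rewrite /laguerre_coef /eta_coef -bin_ffact natrM [(n`!%:R * _)^-1]invfM.
by move: ((N%:R ^+ n)^-1) => y; field.
Qed.

(** The relative error is at most [n^2 / N], and the factor [n^2] raises [s] by two, so the errors
    are dominated by the coefficients of another function of the same family. *)
Lemma eta_coef_sub_laguerre_coef N s n : (0 < N)%N ->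
  0 <= eta_coef s n - laguerre_coef N s n <= eta_coef s.+2 n / N%:R.
Proof.
move=> N0; have /andP[h1 h2] := ffact_ratio_bounds n N0.
have e0 := eta_coef_ge0 s n.
rewrite /laguerre_coef -{1 3}(mulr1 (eta_coef s n)) -mulrBr.
rewrite mulr_ge0 ?subr_ge0//=.
have -> : eta_coef s.+2 n / N%:R = eta_coef s n * (n%:R ^+ 2 / N%:R).
  by rewrite /eta_coef -addn2 exprD; ring.
by rewrite ler_wpM2l//; lra.
Qed.

Lemma laguerre_factorization s N : (0 < N)%N ->
  exists2 l : seq R, {in l, forall a, 0 <= a} &
    forall z, cabs (eta s z - z ^+ (0 < s) * \prod_(a <- l) (1 + toC a * z)) <=
      limn (series (fun n => eta_coef s.+2 n * cabs z ^+ n)) / N%:R.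
Proof.
move=> N0; set m := nat_of_bool (0 < s)%N.
have [Q QR QE] := @real_rooted_laguerre_theta (Cx R) s N N0.
have {}QE n : Q`_n = toC (laguerre_coef N s (n + m)).
  rewrite QE laguerre_coefE !rmorphM/= fmorphV/= rmorphM/= !rmorphXn/=.
  by rewrite !rmorph_nat.
have lag_ge0 n : 0 <= laguerre_coef N s n.
  by rewrite mulr_ge0 ?eta_coef_ge0// divr_ge0 ?exprn_ge0.
have Q0 : Q`_0 = 1.
  rewrite QE add0n laguerre_coefE /m; case: (s) => [|s'] /=.
    by rewrite expr0 bin0 fact0 expr0 !mulr1 divr1 rmorph1.
  rewrite expr1n bin1 factS fact0 muln1 expr1 !mul1r divff ?rmorph1//.
  by rewrite pnatr_eq0 -lt0n.
have Qge0 n : 0 <= Q`_n by rewrite QE -(rmorph0 (@toC R)) le_toC.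
have [l l0 lE] := horner_negative_roots QR Q0 Qge0.
exists l => // z; rewrite -lE.
have sizeQ : (size Q <= N.+1)%N.
  apply/leq_sizeP => n Nn.
  rewrite QE laguerre_coefE bin_small ?mulr0 ?mul0r ?rmorph0//.
  by rewrite ltn_addr.
(* The degree of [z^m Q] is at most [N + 1], so from [N + 2] terms on the partial sums are the whole
   polynomial. *)
have QzE M : (N.+2 <= M)%N -> z ^+ m * Q.[z] =
    series (fun n => toC (laguerre_coef N s n) * z ^+ n) M.
  move=> NM.
  have mM : (m <= M)%N by rewrite (leq_trans _ NM)// /m; case: (0 < s)%N.
  rewrite (@horner_coef_wide _ (M - m)); last first.
    rewrite (leq_trans sizeQ)// leq_subRL// (leq_trans _ NM)// /m.
    by case: (0 < s)%N.
  rewrite /series/= (@big_cat_nat _ _ _ m)//=.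
  (* The only term below [m] is that of index 0 when [s > 0], and it vanishes because [0^s = 0]. *)
  rewrite [X in X + _]big1_seq ?add0r; last first.
    move=> n; rewrite mem_index_iota /m => /=; case: (s) n => [|s'] [|n]//= _.
    by rewrite /laguerre_coef /eta_coef expr0n/= !mul0r.
  rewrite -[X in \sum_(X <= _ < M) _]add0n big_addn big_mkord mulr_sumr.
  apply: eq_bigr => i _.
  by rewrite QE mulrCA -exprD addnC.
set S := limn _.
have cS : series (fun n => eta_coef s.+2 n * cabs z ^+ n) n / N%:R @[n --> \oo]
    --> S / N%:R.
  apply: cvgM; last exact: cvg_cst.
  exact: is_cvg_eta_coef (cabs_ge0 z).
have ce : series (fun n => toC (eta_coef s n) * z ^+ n) n - z ^+ m * Q.[z]
    @[n --> \oo] --> eta s z - z ^+ m * Q.[z].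
  by apply: cvgB; [exact: cvg_eta|exact: cvg_cst].
apply: (cabs_lim_le ce cS); exists N.+2 => // M /= NM.
rewrite (QzE _ NM) /series/= -sumrB mulr_suml (le_trans (ler_cabs_sum _ _ _))//.
apply: ler_sum => n _; rewrite -mulrBl -rmorphB/= cabsM cabsX cabs_toC.
have /andP[h1 h2] := eta_coef_sub_laguerre_coef s n N0.
by rewrite ger0_norm// mulrAC ler_wpM2r// exprn_ge0// cabs_ge0.
Qed.

Lemma eta_LPI_form s : LPI_form (@eta R s).
Proof.
set m := nat_of_bool (0 < s)%N.
have /choice[l /all_and2[l0 lE]] : forall N, exists l : seq R,
    {in l, forall a, 0 <= a} /\ forall z,
    cabs (eta s z - z ^+ m * \prod_(a <- l) (1 + toC a * z)) <=
      limn (series (fun n => eta_coef s.+2 n * cabs z ^+ n)) / N.+1%:R.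
  by move=> N; have [l] := laguerre_factorization s (ltn0Sn N); exists l.
have cP z : z ^+ m * \prod_(a <- l N) (1 + toC a * z) @[N --> \oo] --> eta s z.
  set S := limn (series (fun n => eta_coef s.+2 n * cabs z ^+ n)).
  apply: (@cvgC_squeeze _ _ _ _ _ _ (fun N => S / N.+1%:R)).
    by apply: nearW => N; rewrite cabsB; exact: lE.
  rewrite -(mulr0 S).
  apply: (@cvgM _ _ _ _ (fun=> _) harmonic); first exact: cvg_cst.
  exact: cvg_harmonic.
(* Away from the origin the products converge after division by [z^m]. At [z = 0], where this
   division fails for [s > 0], they are all equal to 1. *)
have /choice[f cf] : forall z, exists w : Cx R,
    (fun N => \prod_(a <- l N) (1 + toC a * z)) @ \oo --> w.
  move=> z; have [->|z0] := eqVneq z 0.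
    exists 1; apply: cvg_near_cst; apply: nearW => N.
    by rewrite big1// => a _; rewrite mulr0 addr0.
  exists (z ^- m * eta s z).
  have -> : (fun N => \prod_(a <- l N) (1 + toC a * z)) =
      (fun N => z ^- m * (z ^+ m * \prod_(a <- l N) (1 + toC a * z))).
    by apply/funext => N; rewrite mulKf// expf_neq0.
  by apply: cvgM; [exact: cvg_cst|exact: cP].
have [sigma [p [sigma0 pP fE]]] := laguerre_polya_limit l0 cf.
exists 1, m, sigma, p; split => // z.
rewrite -mulrA -fE rmorph1 mul1r.
have c2 : z ^+ m * \prod_(a <- l N) (1 + toC a * z) @[N --> \oo]
    --> z ^+ m * f z.
  by apply: cvgM; [exact: cvg_cst|exact: cf].
by rewrite -(cvg_lim _ (cP z))// -(cvg_lim _ c2).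
Qed.

Lemma eta_real s r : eta s (toC r) \is Num.real.
Proof.
have -> : eta s (toC r) = toC (limn (series (fun n => eta_coef s n * r ^+ n))).
  have c : cvgn (series (fun n => eta_coef s n * r ^+ n)).
    apply: normed_cvg.
    apply: (series_le_cvg _ _ _ (@is_cvg_eta_coef s _ (normr_ge0 r))) => n //=.
      by rewrite mulr_ge0 ?eta_coef_ge0 ?exprn_ge0.
    by rewrite normrM normrX ger0_norm ?eta_coef_ge0.
  rewrite -(cvg_lim _ (@cvg_eta s (toC r)))//; apply: cvg_lim => //.
  have -> : series (fun n => toC (eta_coef s n) * toC r ^+ n) =
      (fun n => toC (series (fun n => eta_coef s n * r ^+ n) n)).
    apply/funext => n; rewrite /series/= rmorph_sum/=; apply: eq_bigr => i _.
    by rewrite [RHS]rmorphM/= [toC (r ^+ i)]rmorphXn.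
  by apply: cvg_toC; exact: c.
by rewrite /toC complex_real.
Qed.

End Eta.

Theorem theorem6 (R : realType) (s : nat) : LPplus (@eta R s).
Proof.
split; first split.
- split; last exact: eta_real.
  apply: (@power_series_entire R (eta_coef R s)).
  - exact: eta_coef_ge0.
  - exact: is_cvg_eta_coef.
  - exact: cvg_eta.
- by left; exact: eta_LPI_form.
exists (fun k => k%:R ^+ s / Gamma (k%:R + 1)) => [k|z].
  by rewrite Gamma_nat divr_ge0 ?exprn_ge0.
rewrite eta_termE.
exact: cvg_eta.
Qed.
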